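(* Suppose $E=(X,x_0,h,p)$ and $E'=(X',x_0',h',p')$ are environments where $p\colon\mathcal{U}\times X\to X$ and $p'\colon\mathcal{U}\times X'\to X'$ are path actions, and assume that $\mathcal{U}$ is closed under $\oplus$. Then $E\equiv E'$ if and only if there is a bisimulation $R\subseteq X\times X'$ between $E$ and $E'$.
   Context: Control signals. Let $U$ be a nonempty set and let $U^*$ be the set of all functions $\bar u\colon[0,T)\to U$ with $T\in\mathbb{R}_{\ge 0}$ (for $T=0$ this is the empty function $\varnothing$). Write $|\bar u|=T$. For $t\in\mathbb{R}_{\ge0}$, $\bar u_{<t}$ is the restriction of $\bar u$ to $[0,t)$ (equal to $\bar u$ if $t\ge|\bar u|$), and $\bar u_{\ge t}$ is the final segment, i.e. the function with domain $[0,|\bar u|-t)$ (empty if $t\ge|\bar u|$) given by $s\mapsto\bar u(t+s)$. Write $\bar u_1\lhd\bar u_2$ if $|\bar u_1|<|\bar u_2|$ and $(\bar u_2)_{<|\bar u_1|}=\bar u_1$. The concatenation $\bar u_1\oplus\bar u_2$ has domain $[0,|\bar u_1|+|\bar u_2|)$ and equals $\bar u_1(t)$ for $t<|\bar u_1|$ and $\bar u_2(t-|\bar u_1|)$ otherwise. A space of control signals is a nonempty subset $\mathcal{U}\subseteq U^*$ that is (i) closed under segmentation: for all $\bar u\in\mathcal{U}$ and $t\ge0$, $\bar u_{<t},\bar u_{\ge t}\in\mathcal{U}$; (ii) extensive: for every $\bar u\in\mathcal{U}$ there is $\bar u_1\in\mathcal{U}$ with $\bar u\lhd\bar u_1$ and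 $|\bar u_1|\ge|\bar u|+1$; and (iii) equipped with a topology for which $\mathcal{U}\to\mathbb{R}_{\ge0}$, $\bar u\mapsto|\bar u|$, and $\mathcal{U}\times\mathbb{R}_{\ge0}\to\mathcal{U}$, $(\bar u,t)\mapsto\bar u_{<t}$, are continuous. $\mathcal{U}$ is closed under $\oplus$ if $\bar u_0\oplus\bar u_1\in\mathcal{U}$ whenever $\bar u_0,\bar u_1\in\mathcal{U}$. Throughout, a space of control signals $\mathcal{U}$, assumed Polish, and a topological space $Y$ (the observation space) are fixed. Path action. A path action of $\mathcal{U}$ on $X$ is a continuous function $p\colon\mathcal{U}\times X\to X$ such that $p(\varnothing,x)=x$ for all $x\in X$, and $p(\bar u,x)=p(\bar u_{\ge t},p(\bar u_{<t},x))$ for all $x\in X$, $\bar u\in\mathcal{U}$, $t\in\mathbb{R}_{\ge0}$. Environments (with path actions). Here an environment is a tuple $E=(X,x_0,h,p)$ where $X$ is a Polish space, $x_0\in X$, $h\colon X\to Y$ is a Borel map (preimages of open sets are Borel), and $p$ is a path action of $\mathcal{U}$ on $X$. Equivalence. A branch through $\mathcal{U}$ is a function $\mathbf{u}\colon\mathbb{R}_{\ge0}\to U$ with $\mathbf{u}_{<t}=\mathbf{u}\restriction[0,t)\in\mathcal{U}$ for all $t\ge 0$. The full sensory history in $E$ is $\mathbf{y}^E_{\mathbf{u}}\colon\mathbb{R}_{\ge0}\to Y$, $\mathbf{y}^E_{\mathbf{u}}(t)=h(p(\mathbf{u}_{<t},x_0))$. $E\equiv E'$ means $\mathbf{y}^E_{\mathbf{u}}=\mathbf{y}^{E'}_{\mathbf{u}}$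 for every branch $\mathbf{u}$ through $\mathcal{U}$. Bisimulation. A relation $R\subseteq X\times X'$ is a bisimulation between $E$ and $E'$ if $(x_0,x_0')\in R$ and for all $(x,x')\in R$: $h(x)=h'(x')$, and for all $\bar u\in\mathcal{U}$, $(p(\bar u,x),p'(\bar u,x'))\in R$. *)

(* Defs.v *)
From HB Require Import structures.
From mathcomp Require Import all_boot all_order all_algebra.
From mathcomp Require Import all_classical all_reals all_analysis.
Import Order.TTheory GRing.Theory Num.Theory.
Import numFieldNormedType.Exports.

Set Implicit Arguments.
Unset Strict Implicit.
Unset Printing Implicit Defensive.

Local Open Scope classical_set_scope.
Local Open Scope ring_scope.

(* As a type, [time R] carries the subspace topology inherited from R. *)
Definition time (R : realType) : set R := [set t | 0 <= t].
Arguments time R : clear implicits.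

Section Time.
Context {R : realType}.

Definition mk_time (t : R) (t0 : 0 <= t) : time R := exist _ t (mem_set t0).

Lemma time_ge0 (t : time R) : 0 <= \val t.
Proof. exact: set_mem (valP t). Qed.

Definition time0 : time R := mk_time (lexx 0).

Lemma min_time_subproof (s t : time R) : 0 <= Num.min (\val s) (\val t).
Proof. by rewrite le_min !time_ge0. Qed.
Definition min_time (s t : time R) : time R := mk_time (min_time_subproof s t).

Lemma add_time_subproof (s t : time R) : 0 <= \val s + \val t.
Proof. by rewrite addr_ge0 ?time_ge0. Qed.
Definition add_time (s t : time R) : time R := mk_time (add_time_subproof s t).

Lemma sub_time_subproof (s t : time R) : 0 <= Num.max 0 (\val s - \val t).
Proof. by rewrite le_max lexx. Qed.
Definition sub_time (s t : time R) : time R := mk_time (sub_time_subproof s t).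

End Time.

(* A function [0, T) -> U is encoded as a partial function on R whose domain
   of definition is exactly [0, T). *)
Record signal (R : realType) (U : Type) := Signal {
  sig_len : time R;
  sig_fun :> R -> option U;
  sig_dom : forall s, isSome (sig_fun s) = (0 <= s < \val sig_len) }.

HB.instance Definition _ (R : realType) (U : Type) :=
  gen_eqMixin (signal R U).
HB.instance Definition _ (R : realType) (U : Type) :=
  gen_choiceMixin (signal R U).

Section Signals.
Context {R : realType} {U : Type}.
Implicit Types (u v : signal R U) (t : time R).

Lemma sig_ext u v :
  sig_len u = sig_len v -> (forall s, u s = v s) -> u = v.
Proof.
case: u v => [l f d] [l' f' d'] /= ll' /funext ff'.
by case: _ / ll' d'; case: _ / ff' => d'; congr Signal; exact: Prop_irrelevance.
Qed.

Lemma sig_empty_subproof (s : R) :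
  isSome (None : option U) = (0 <= s < \val (@time0 R)).
Proof. by rewrite /= leNgt andNb. Qed.
Definition sig_empty : signal R U := Signal sig_empty_subproof.

Lemma sig_take_subproof u t s :
  isSome (if s < \val t then u s else None)
    = (0 <= s < \val (min_time (sig_len u) t)).
Proof.
by rewrite /= lt_min andbA -sig_dom; case: ifP => _; rewrite ?andbT ?andbF.
Qed.
Definition sig_take u t : signal R U := Signal (sig_take_subproof u t).

Lemma sig_drop_subproof u t s :
  isSome (if 0 <= s then u (\val t + s) else None)
    = (0 <= s < \val (sub_time (sig_len u) t)).
Proof.
rewrite /= lt_max ltrBrDl.
case: ifP => //= s0; rewrite sig_dom addr_ge0 ?time_ge0//=.
by rewrite ltNge s0.
Qed.
Definition sig_drop u t : signal R U := Signal (sig_drop_subproof u t).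

Lemma sig_cat_subproof u v s :
  isSome (if s < \val (sig_len u) then u s else v (s - \val (sig_len u)))
    = (0 <= s < \val (add_time (sig_len u) (sig_len v))).
Proof.
have u0 := time_ge0 (sig_len u); have v0 := time_ge0 (sig_len v).
case: ltP => su; rewrite sig_dom /=.
  by rewrite su (lt_le_trans su) ?lerDl.
by rewrite subr_ge0 su (le_trans u0 su) ltrBlDl.
Qed.
Definition sig_cat u v : signal R U := Signal (sig_cat_subproof u v).

Definition sig_lhd u v : Prop :=
  \val (sig_len u) < \val (sig_len v) /\ sig_take v (sig_len u) = u.

Lemma sig_restr_subproof (b : time R -> U) t s :
  isSome (if s < \val t then omap b (insub s) else None)
    = (0 <= s < \val t).
Proof.
case: ifP => st; last by rewrite andbF.
rewrite andbT; case: insubP => [x /set_mem xs _|ns] /=; first by rewrite xs.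
by apply/esym/negbTE/negP => s0; move/negP: ns; apply; exact: mem_set.
Qed.
Definition sig_restr (b : time R -> U) t : signal R U :=
  Signal (sig_restr_subproof b t).

End Signals.

(* The ambient set of all signals carries no topology: the open sets of the
   subset [cs_set] are part of the structure. *)
Record signal_space (R : realType) (U : Type) := SignalSpace {
  cs_set : set (signal R U);
  cs_open : set (set cs_set);
  cs_openT : cs_open setT;
  cs_openI : forall A B : set cs_set,
    cs_open A -> cs_open B -> cs_open (A `&` B);
  cs_open_bigU : forall (I : Type) (F : I -> set cs_set),
    (forall i, cs_open (F i)) -> cs_open (\bigcup_i F i) }.

Definition cs_type (R : realType) (U : Type) (S : signal_space R U) : Type :=
  set_type (cs_set S).

HB.instance Definition _ (R : realType) (U : Type) (S : signal_space R U) :=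
  SubChoice.on (cs_type S).
HB.instance Definition _ (R : realType) (U : Type) (S : signal_space R U) :=
  isOpenTopological.Build (cs_type S)
    (@cs_openT R U S) (@cs_openI R U S) (@cs_open_bigU R U S).

Coercion cs_type : signal_space >-> Sortclass.

Definition cs_mk (R : realType) (U : Type) (S : signal_space R U)
    (u : signal R U) (Su : cs_set S u) : S := exist _ u (mem_set Su).

Lemma cs_mem (R : realType) (U : Type) (S : signal_space R U) (u : S) :
  cs_set S (\val u).
Proof. exact: set_mem (valP u). Qed.

Record control_space (R : realType) (U : Type) := ControlSpace {
  cs_space :> signal_space R U;
  cs_nonempty : cs_set cs_space !=set0;
  cs_take_closed : forall (u : signal R U) (t : time R),
    cs_set cs_space u -> cs_set cs_space (sig_take u t);
  cs_drop_closed : forall (u : signal R U) (t : time R),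
    cs_set cs_space u -> cs_set cs_space (sig_drop u t);
  cs_extensive : forall u, cs_set cs_space u ->
    exists v, [/\ cs_set cs_space v, sig_lhd u v &
                  \val (sig_len u) + 1 <= \val (sig_len v)];
  cs_len_continuous : continuous (fun u : cs_space => sig_len (\val u));
  cs_take_continuous : continuous (fun ut : cs_space * time R =>
    cs_mk (cs_take_closed ut.2 (cs_mem ut.1))) }.

Definition closed_under_cat (R : realType) (U : Type) (C : control_space R U) :=
  forall u v : signal R U, cs_set C u -> cs_set C v -> cs_set C (sig_cat u v).

Section ControlSpaceOps.
Context {R : realType} {U : Type} (C : control_space R U).

Definition cs_take (u : C) (t : time R) : C :=
  cs_mk (cs_take_closed t (cs_mem u)).

Definition cs_drop (u : C) (t : time R) : C :=
  cs_mk (cs_drop_closed t (cs_mem u)).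

Lemma cs_empty_subproof : cs_set C sig_empty.
Proof.
have [u Cu] := cs_nonempty C.
have := cs_take_closed time0 Cu; congr (cs_set C _).
apply: sig_ext => [|s /=].
  by apply: val_inj => /=; apply/min_idPr; exact: time_ge0.
case: ifP => // s0; have := sig_dom u s; rewrite leNgt s0 /=.
by case: (u s).
Qed.

Definition cs_empty : C := cs_mk cs_empty_subproof.

Record branch := Branch {
  branch_fun :> time R -> U;
  branch_mem : forall t, cs_set C (sig_restr branch_fun t) }.

Definition branch_take (b : branch) (t : time R) : C := cs_mk (branch_mem b t).

End ControlSpaceOps.

Definition homeomorphic (X Z : topologicalType) : Prop :=
  exists (f : X -> Z) (g : Z -> X),
    [/\ cancel f g, cancel g f, continuous f & continuous g].

Definition separable (X : topologicalType) : Prop :=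
  exists2 D : set X, countable D & dense D.

Definition complete (X : uniformType) : Prop :=
  forall F : set_system X, ProperFilter F -> cauchy F -> exists x : X, F --> x.

(* [M] need not be nonempty, unlike a [completePseudoMetricType]. *)
Definition polish (R : realType) (X : topologicalType) : Prop :=
  separable X /\ exists M : metricType R, complete M /\ homeomorphic X M.

Definition borel_map (X Y : topologicalType) (h : X -> Y) : Prop :=
  forall O : set Y, open O -> <<s @open X >> (h @^-1` O).

Definition path_action (R : realType) (U : Type) (C : control_space R U)
    (X : topologicalType) (p : C * X -> X) : Prop :=
  [/\ continuous p,
      forall x, p (cs_empty C, x) = x &
      forall (x : X) (u : C) (t : time R),
        p (u, x) = p (cs_drop u t, p (cs_take u t, x))].

Record environment (R : realType) (U : Type) (C : control_space R U)
    (Y : topologicalType) := Environment {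
  env_state :> topologicalType;
  env_polish : polish R env_state;
  env_init : env_state;
  env_obs : env_state -> Y;
  env_borel : borel_map env_obs;
  env_act : C * env_state -> env_state;
  env_path_action : path_action env_act }.

Section Environments.
Context {R : realType} {U : Type} {C : control_space R U} {Y : topologicalType}.
Implicit Types E : environment C Y.

Definition sensory_history E (b : branch C) : time R -> Y :=
  fun t => env_obs (env_act (branch_take b t, env_init E)).

Definition equivalent E E' : Prop :=
  forall b : branch C, sensory_history E b = sensory_history E' b.

Definition bisimulation E E' (B : set (E * E')) : Prop :=
  B (env_init E, env_init E') /\
  forall (x : E) (x' : E'), B (x, x') ->
    env_obs x = env_obs x' /\
    forall u : C, B (env_act (u, x), env_act (u, x')).

End Environments.

(* Main.v *)
(** Given equivalence, the relation consisting of all pairs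
    [(p(u, x0), p'(u, x0'))] with [u] in the space of control signals is a
    bisimulation. It is closed under the actions because [p(v, p(u, x0))] is
    [p(u (+) v, x0)], and it respects observations because extensivity lets
    every control signal be prolonged to a branch. *)
Require Import Defs.
From mathcomp Require Import all_boot all_order all_algebra.
From mathcomp Require Import all_classical all_reals all_analysis.
Import Order.TTheory GRing.Theory Num.Theory.

Set Implicit Arguments.
Unset Strict Implicit.
Unset Printing Implicit Defensive.

Local Open Scope classical_set_scope.
Local Open Scope ring_scope.

Section Signals.
Context {R : realType} {U : Type}.
Implicit Types u v : signal R U.

Lemma sig_take_cat u v : sig_take (sig_cat u v) (sig_len u) = u.
Proof.
apply: sig_ext => [|s /=].
  by apply: val_inj => /=; apply/min_idPr; rewrite lerDl time_ge0.
case: ifP => su; first by rewrite su.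
by have := sig_dom u s; rewrite su andbF; case: (u s).
Qed.

Lemma sig_drop_cat u v : sig_drop (sig_cat u v) (sig_len u) = v.
Proof.
apply: sig_ext => [|s /=].
  by apply: val_inj; rewrite /= addrAC subrr add0r; apply/max_idPr/time_ge0.
case: ifP => s0; first by rewrite ltNge lerDl s0 /= addrAC subrr add0r.
by have := sig_dom v s; rewrite s0; case: (v s).
Qed.

Lemma sig_lhd_fun u v s : sig_lhd u v -> s < \val (sig_len u) -> v s = u s.
Proof. by move=> [_ vu] su; rewrite -[in RHS]vu /= su. Qed.

End Signals.

Section Branches.
Context {R : realType} {U : Type} (C : control_space R U).

(** Signals of a chain agree wherever two of them are defined, and their lengths are unbounded, so
    they glue to a total function on [time R]. Each restriction of it truncates some [v n], hence
    lies in the space by closure under segmentation. *)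
Lemma branch_of_chain (v : nat -> C) :
  inhabited U ->
  (forall n, sig_lhd (\val (v n)) (\val (v n.+1))) ->
  (forall n, n%:R <= \val (sig_len (\val (v n)))) ->
  exists b : branch C,
    forall n, branch_take b (sig_len (\val (v n))) = v n.
Proof.
move=> [c] v_lhd v_len.
have v_mono (n m : nat) : (n <= m)%N ->
    \val (sig_len (\val (v n))) <= \val (sig_len (\val (v m))).
  elim: m => [|m IH]; first by rewrite leqn0 => /eqP ->.
  rewrite leq_eqVlt => /predU1P[-> //|/IH nm].
  by apply: le_trans nm _; exact: ltW (v_lhd m).1.
have v_agree_le (n m : nat) s : (n <= m)%N ->
    s < \val (sig_len (\val (v n))) -> (\val (v m)) s = (\val (v n)) s.
  move=> + sn; elim: m => [|m IH]; first by rewrite leqn0 => /eqP ->.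
  rewrite leq_eqVlt => /predU1P[-> //|nm].
  rewrite -IH//; apply: (sig_lhd_fun (v_lhd m)).
  by apply: lt_le_trans sn _; exact: v_mono.
have v_agree (n m : nat) s : s < \val (sig_len (\val (v n))) ->
    s < \val (sig_len (\val (v m))) -> (\val (v m)) s = (\val (v n)) s.
  by move=> sn sm; case: (leqP n m) => [|/ltnW] nm; [|apply: esym];
    exact: v_agree_le.
(* An index whose signal outlasts [t]: [v n] has length at least [n]. *)
pose N (t : R) := (Num.truncn t).+1.
have N_lt (t : R) : t < \val (sig_len (\val (v (N t)))).
  by apply: lt_le_trans (v_len _); exact: truncnS_gt.
(* The default [c] is never taken, since [t] lies in the domain of [v (N t)]; it only makes [b]
   total. *)
pose b (t : time R) : U := odflt c ((\val (v (N (\val t)))) (\val t)).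
have restr_b n (t : time R) : \val t <= \val (sig_len (\val (v n))) ->
    sig_restr b t = sig_take (\val (v n)) t.
  move=> tn; apply: sig_ext => [|s /=].
    by apply/esym/val_inj => /=; exact/min_idPr.
  case: ifP => // st; have sn := lt_le_trans st tn.
  case: insubP => [x /set_mem s0 xs|ns] /=.
    rewrite /b xs -(v_agree _ n) //; have := sig_dom (\val (v n)) s.
    by rewrite s0 sn; case: ((\val (v n)) s).
  have := sig_dom (\val (v n)) s; rewrite sn andbT.
  case: (boolP (0 <= s)) => [s0|_]; last by case: ((\val (v n)) s).
  by move: ns; rewrite mem_set.
have b_mem t : cs_set C (sig_restr b t).
  by rewrite (restr_b (N (\val t))) ?ltW//; apply/cs_take_closed/cs_mem.
exists (Branch b_mem) => n; apply: val_inj => /=.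
(* Truncating [v n] at its own length changes nothing. *)
rewrite (restr_b n)//; apply: sig_ext => [|s /=].
  by apply: val_inj => /=; rewrite minxx.
case: ifP => // sn; have := sig_dom (\val (v n)) s.
by rewrite sn andbF; case: ((\val (v n)) s).
Qed.

(** Extensivity, iterated from [u] by choice, gives a chain; each step adds at least 1 to the
    length, so the [n]-th term has length at least [n]. *)
Lemma branch_extends (u : C) :
  inhabited U -> exists b : branch C, branch_take b (sig_len (\val u)) = u.
Proof.
move=> U_nonempty.
have /choice[f f_ext] (w : C) : exists w' : C, sig_lhd (\val w) (\val w') /\
    \val (sig_len (\val w)) + 1 <= \val (sig_len (\val w')).
  by have [w' [Cw' ww' len]] := cs_extensive (cs_mem w); exists (cs_mk Cw').
have [n||b b_take] := @branch_of_chain (fun n => iter n f u) U_nonempty.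
- exact: (f_ext _).1.
- elim=> [|n IH]; first exact: time_ge0.
  by apply: le_trans (f_ext _).2; rewrite -natr1 lerD2r.
- by exists b; exact: (b_take 0%N).
Qed.

Definition cs_cat (C_cat : closed_under_cat C) (u v : C) : C :=
  cs_mk (C_cat _ _ (cs_mem u) (cs_mem v)).

(** The segmentation law of [p], cut at the length of [u], where the concatenation splits back into
    [u] and [v]. *)
Lemma path_action_cat (C_cat : closed_under_cat C) (X : topologicalType)
    (p : C * X -> X) (u v : C) (x : X) :
  path_action p -> p (cs_cat C_cat u v, x) = p (v, p (u, x)).
Proof.
case=> _ _ /(_ x (cs_cat C_cat u v) (sig_len (\val u))) ->.
congr (p (_, p (_, x))); apply: val_inj; first exact: sig_drop_cat.
exact: sig_take_cat.
Qed.

End Branches.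

Theorem theorem7p4 (R : realType) (U : Type) (U_nonempty : inhabited U)
    (C : control_space R U) (C_polish : polish R C) (Y : topologicalType)
    (E E' : environment C Y) (C_cat : closed_under_cat C) :
  equivalent E E' <-> exists B : set (E * E'), bisimulation B.
Proof.
split=> [EE'|[B [B0 B_step]] b]; last first.
  (* Acting on the initial pair by the whole signal up to time [t] reaches, in one step, the two
     states observed at [t]. *)
  apply/funext => t; have [_ /(_ (branch_take b t)) Bt] := B_step _ _ B0.
  exact: (B_step _ _ Bt).1.
exists (range (fun u : C => (env_act (u, env_init E), env_act (u, env_init E')))).
split.
  exists (cs_empty C) => //.
  by have [_ -> _] := env_path_action E; have [_ -> _] := env_path_action E'.
move=> _ _ [u _ [<- <-]]; split=> [|v].
  (* Along a branch prolonging [u], the observation at time [|u|] is that of the state reached by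
     [u]. *)
  have [b bu] := branch_extends u U_nonempty.
  by have /(congr1 (@^~ (sig_len (\val u)))) := EE' b; rewrite /sensory_history bu.
exists (cs_cat C_cat u v) => //.
by rewrite !path_action_cat//; exact: env_path_action.
Qed.
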